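(* Any $p$-pass streaming algorithm giving a multiplicative approximation for \textsc{fas-size-t} (with success probability at least $2/3$) requires $\Omega(n/p)$ space.
   Context: Input: an $n$-vertex tournament $G=(V,E)$ presented as a stream of edges in arbitrary order. For an ordering (bijection) $\sigma\colon V\to[n]$, $B_G(\sigma)=\{(v,u)\in E:\sigma(u)<\sigma(v)\}$ and $\beta_G=\min_\sigma|B_G(\sigma)|$. \textsc{fas-size-t} ($\alpha$-approximation): under the promise that $G$ is a tournament, output an integer $\hat\beta\in[\beta_G,\alpha\beta_G]$. *)

(* Defs.v *)
From HB Require Import structures.
From mathcomp Require Import all_boot all_order all_algebra all_fingroup.
From mathcomp Require Import all_classical all_reals all_analysis.

Set Implicit Arguments.
Unset Strict Implicit.
Unset Printing Implicit Defensive.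

Import Order.TTheory GRing.Theory Num.Theory.

Local Open Scope ring_scope.

(* A directed graph on the vertex set 'I_n is its set of edges, the pair
   (u, v) standing for the edge from u to v. *)
Definition tournament (n : nat) (E : {set 'I_n * 'I_n}) : Prop :=
  (forall v, (v, v) \notin E) /\
  (forall u v, u != v -> ((u, v) \in E) (+) ((v, u) \in E)).

(* A permutation of 'I_n is exactly a bijection from the vertices to the
   n positions (numbered from 0 instead of 1). *)
Definition back_edges (n : nat) (E : {set 'I_n * 'I_n}) (sigma : 'S_n) :
    {set 'I_n * 'I_n} :=
  [set e in E | (sigma e.2 < sigma e.1)%N].

Definition min_fas (n : nat) (E : {set 'I_n * 'I_n}) : nat :=
  #|back_edges E [arg min_(sigma < 1%g) #|back_edges E sigma|]|.

(* Every edge occurs exactly once, in an arbitrary order. *)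
Definition edge_stream (n : nat) (E : {set 'I_n * 'I_n})
    (st : seq ('I_n * 'I_n)) : Prop :=
  perm_eq st (enum E).

(* A streaming algorithm for n-vertex graphs with s bits of memory.  All its
   randomness is a seed w : T, drawn once; reading it is not charged as space,
   and neither is the clock (pass number i, position j in the stream) given to
   sa_update.  Fresh coins at every step are the special case in which
   sa_update only looks at a component of w indexed by (i, j). *)
Record stream_alg (n s : nat) (T : Type) := StreamAlg {
  sa_init : T -> s.-tuple bool;
  sa_update : T -> nat -> nat -> s.-tuple bool -> 'I_n * 'I_n -> s.-tuple bool;
  sa_output : T -> s.-tuple bool -> int
}.

Definition sa_pass (n s : nat) (T : Type) (A : stream_alg n s T) (w : T)
    (st : seq ('I_n * 'I_n)) (m : s.-tuple bool) (i : nat) : s.-tuple bool :=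
  foldl (fun m' je => sa_update A w i je.1 m' je.2) m
    (zip (iota 0 (size st)) st).

Definition sa_run (n s : nat) (T : Type) (A : stream_alg n s T) (p : nat)
    (w : T) (st : seq ('I_n * 'I_n)) : int :=
  sa_output A w (foldl (sa_pass A w st) (sa_init A w) (iota 0 p)).

Definition fas_size_approx (R : realType) (n : nat) (alpha : R)
    (E : {set 'I_n * 'I_n}) (b : int) : Prop :=
  (min_fas E)%:R <= b%:~R :> R /\ b%:~R <= alpha * (min_fas E)%:R.

(* With p passes over the same stream, A solves fas-size-t within the factor
   alpha: the success probability is at least 2/3 on every tournament and every
   order of arrival of its edges. *)
Definition solves_fas_size_t (R : realType) (n s : nat) (d : measure_display)
    (T : measurableType d) (P : probability T R) (A : stream_alg n s T)
    (p : nat) (alpha : R) : Prop :=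
  forall (E : {set 'I_n * 'I_n}) (st : seq ('I_n * 'I_n)),
    tournament E -> edge_stream E st ->
    let success := [set w | fas_size_approx alpha E (sa_run A p w st)]%classic in
    measurable success /\ ((2 / 3)%:E <= P success)%E.

(* Main.v *)
Require Import Defs.
From mathcomp Require Import all_boot all_order all_algebra all_fingroup.
From mathcomp Require Import all_classical all_reals all_analysis.
From mathcomp Require Import measurable_realfun ring lra zify.

(* A triple of vertices a, b, c with c -> a, in which x decides the edge a - b
   and y the edge b - c, is cyclic exactly when x = y = 1.  Placing n / 3 such
   triples one after the other and streaming first the edges that depend on x
   and then those that depend on y, an algorithm with p passes and s bits tells
   disjoint sets x, y (acyclic tournament, min_fas 0) from intersecting ones,
   with 2 p messages of s bits.

   Set disjointness is hard by a corruption argument in the style of Razborov.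
   Let P S be the mean of f over the subsets of S, and Q likewise for g.  For a
   rectangle f x * g y, compare the sum of P S * Q (~: S), over disjoint pairs,
   with the sum over i and T not containing i of the means of f and g over the
   sets i |: x, i |: y with x in T and y in ~: (i |: T), over pairs meeting
   exactly in i.  The two differ through the influences |P S - P (S :\ i)|,
   whose sum over i in S is at most |S| / 8 * P S up to an error rho ^+ #|S|
   with rho < 1.  Hence each of the 2 ^ O(p s) rectangles of the protocol that
   accepts most of the disjoint pairs accepts too many intersecting ones, up
   to an error exponentially small in n. *)

Set Implicit Arguments.
Unset Strict Implicit.
Unset Printing Implicit Defensive.

Import Order.TTheory GRing.Theory Num.Theory.

Local Open Scope ring_scope.

(** * Influences on the cube and corruption of rectangles *)

Section Cube.
Import mathcomp.boot.finset.
Context {R : realType} {V : finType}.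
Implicit Types (f g : {set V} -> R) (S x : {set V}) (i : V).

Lemma sum_set_split i (F : {set V} -> R) :
  \sum_x F x = \sum_(x : {set V} | i \notin x) (F x + F (i |: x)).
Proof.
rewrite big_split /= (bigID (fun x : {set V} => i \notin x)) /=; congr (_ + _).
rewrite (reindex_onto (fun x => i |: x) (fun x => x :\ i)) /=; last first.
  by move=> x; rewrite negbK => ix; rewrite setD1K.
apply: eq_bigl => x; rewrite setU11 /=.
by apply/eqP/idP => [<-|/setU1K //]; rewrite !inE eqxx.
Qed.

Lemma card_setT_exp : #|{: {set V}}| = (2 ^ #|V|)%N.
Proof. by rewrite -(cardsT {set V}) -powersetT card_powerset cardsT. Qed.

(* The mean of f over a uniformly random subset of S. *)
Definition pavg f S : R := (\sum_x f (x :&: S)) / 2 ^+ #|V|.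
Definition pavg1 f i S : R := (\sum_x f (i |: (x :&: S))) / 2 ^+ #|V|.

Lemma pavg_ge0 f S : (forall x, 0 <= f x) -> 0 <= pavg f S.
Proof. by move=> f0; rewrite divr_ge0 ?exprn_ge0 ?sumr_ge0. Qed.

Lemma pavg1_ge0 f i S : (forall x, 0 <= f x) -> 0 <= pavg1 f i S.
Proof. by move=> f0; rewrite divr_ge0 ?exprn_ge0 ?sumr_ge0. Qed.

Lemma pavg_le1 f S : (forall x, f x <= 1) -> pavg f S <= 1.
Proof.
move=> f1; rewrite ler_pdivrMr ?exprn_gt0// mul1r.
rewrite (le_trans (ler_sum _ (fun x _ => f1 _)))//.
by rewrite sumr_const card_setT_exp natrX.
Qed.

Lemma setI_setU1_notin x i S : i \notin x -> x :&: (i |: S) = x :&: S.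
Proof.
move=> ix; apply/setP => j; rewrite !inE; case: eqP => // ->.
by rewrite (negPf ix).
Qed.

Lemma setU1I_notin x i S : i \notin S -> (i |: x) :&: S = x :&: S.
Proof. by move=> iS; rewrite setIC setI_setU1_notin// setIC. Qed.

(** A uniform subset of [i |: S] contains [i] with probability one half. *)
Lemma pavg_setU1 f i S : i \notin S ->
  2 * pavg f (i |: S) = pavg f S + pavg1 f i S.
Proof.
move=> iS; rewrite /pavg /pavg1 -mulrDl mulrA; congr (_ / _).
rewrite -big_split !(sum_set_split i) /= mulr_sumr; apply: eq_bigr => x ix.
by rewrite -setUIr setI_setU1_notin// setU1I_notin//; ring.
Qed.

(** The sets [x] and [i |: x] have the same trace on [S :\ i], so only the signed difference of
    their values on [S] remains. *)
Lemma pavg_diff f i S : i \in S ->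
  pavg f S - pavg f (S :\ i) =
  (\sum_(x : {set V}) (-1) ^+ (i \notin x) * f (x :&: S)) / 2 ^+ #|V|.
Proof.
move=> iS; rewrite /pavg -mulrBl; congr (_ / _).
have iS' : i \notin S :\ i by rewrite !inE eqxx.
rewrite -[in RHS](setD1K iS) -{1}(setD1K iS); move: (S :\ i) iS' => S' iS'.
rewrite -sumrB !(sum_set_split i); apply: eq_bigr => x ix.
rewrite -setUIr setI_setU1_notin// setU1I_notin//.
by rewrite ix setU11 /=; ring.
Qed.

Lemma sum_set_prod (a b : V -> R) :
  \sum_(x : {set V}) \prod_i (if i \in x then a i else b i) =
  \prod_i (a i + b i).
Proof. by rewrite bigA_distr. Qed.

Definition rho : R := 299 / 300.

(* With lambda = 1/100 the two exponentials are at most 1 / (1 - 7 lambda) and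
   1 / (1 + 9 lambda), whose mean is below 1. *)
Lemma exp_mean_le : expR (7 / 100) + expR (- (9 / 100)) <= 2 * rho.
Proof.
have h (y : R) : y < 1 -> expR y <= (1 - y)^-1.
  move=> y1; rewrite -[leLHS]invrK -expRN lef_pV2 ?posrE ?expR_gt0 ?subr_gt0//.
  exact: expR_ge1Dx.
have h1 : expR (7 / 100 : R) <= _ := h (7 / 100) ltac:(lra).
have h2 : expR (- (9 / 100) : R) <= _ := h (- (9 / 100)) ltac:(lra).
apply: (le_trans (lerD h1 h2)); rewrite /rho.
have -> : (1 - 7 / 100 : R)^-1 = 100 / 93 by field.
have -> : (1 - - (9 / 100) : R)^-1 = 100 / 109 by field.
lra.
Qed.

(* A Fourier coefficient of f against +-1 characters: Markov's inequality for
   the exponential moment replaces the usual entropy estimate. *)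
Lemma pavg_influence f S : (forall x, 0 <= f x <= 1) ->
  \sum_(i in S) `|pavg f S - pavg f (S :\ i)| <=
  #|S|%:R / 8 * pavg f S + 25 / 2 * rho ^+ #|S|.
Proof.
move=> f01.
(* Fixing the sign of each difference turns the sum of absolute values into the mean of one function
   [t] against [f]. *)
pose b i := pavg f S - pavg f (S :\ i) < 0.
pose t (x : {set V}) : R := \sum_(i in S) (-1) ^+ (b i (+) (i \notin x)).
pose w (x : {set V}) : R := \prod_(i in S)
  expR ((8 * (-1) ^+ (b i (+) (i \notin x)) - 1) / 100).
have wE x : w x = expR ((8 * t x - #|S|%:R) / 100).
  rewrite /w -expR_sum; congr expR.
  rewrite -mulr_suml; congr (_ / _).
  by rewrite sumrB -mulr_sumr sumr_const.
(* Use [1 + z <= expR z] at [z = (8 * t x - #|S|) / 100]; the factor [25 / 2] is [100 / 8]. *)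
have tw x : t x <= #|S|%:R / 8 + 25 / 2 * w x.
  by rewrite wE; have := expR_ge1Dx ((8 * t x - #|S|%:R) / 100); lra.
have sumt : \sum_(i in S) `|pavg f S - pavg f (S :\ i)| =
    (\sum_x t x * f (x :&: S)) / 2 ^+ #|V|.
  transitivity (\sum_(i in S) (\sum_(x : {set V}) (-1) ^+ (b i (+) (i \notin x)) *
                                 f (x :&: S)) / 2 ^+ #|V|).
    apply: eq_bigr => i iS.
    have -> : `|pavg f S - pavg f (S :\ i)| =
        (-1) ^+ b i * (pavg f S - pavg f (S :\ i)).
      rewrite /b; case: ltP => h; rewrite ?mulN1r ?mul1r.
        by rewrite ltr0_norm.
      by rewrite ger0_norm.
    rewrite pavg_diff// mulrA; congr (_ / _); rewrite mulr_sumr.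
    by apply: eq_bigr => x _; rewrite mulrA signr_addb.
  rewrite -mulr_suml exchange_big /=; congr (_ / _).
  by apply: eq_bigr => x _; rewrite mulr_suml.
(* Coordinates are independent: each [i] in [S] contributes the two exponentials of [exp_mean_le],
   any other [i] a factor 2. *)
have sumw : \sum_x w x <= 2 ^+ #|V| * rho ^+ #|S|.
  pose E (c : bool) : R := expR ((8 * (-1) ^+ c - 1) / 100).
  apply: (@le_trans _ _ (\sum_(x : {set V}) \prod_i
    (if i \in x then (if i \in S then E (b i) else 1)
     else (if i \in S then E (~~ b i) else 1)))).
    apply: ler_sum => x _; rewrite /w big_mkcond /=; apply: ler_prod => i _.
    case: (i \in S); case: (i \in x); rewrite ?ler01 ?lexx// ?addbF ?addbT;
      by rewrite expR_ge0 /=.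
  rewrite sum_set_prod.
  apply: (@le_trans _ _ (\prod_(i : V) (2 * (if i \in S then rho else 1)))).
    apply: ler_prod => i _; case: ifP => _; last by lra.
    have E0 : E false = expR (7 / 100) by rewrite /E; congr expR; lra.
    have E1 : E true = expR (- (9 / 100)) by rewrite /E; congr expR; lra.
    rewrite addr_ge0 ?expR_ge0//=.
    by case: (b i); rewrite /= E0 E1 ?[_ + expR (7 / 100)]addrC exp_mean_le.
  by rewrite big_split /= prodr_const -big_mkcond /= prodr_const.
rewrite sumt ler_pdivrMr ?exprn_gt0//.
apply: (@le_trans _ _ (\sum_x (#|S|%:R / 8 * f (x :&: S) + 25 / 2 * w x))).
  apply: ler_sum => x _; have /andP[f0 f1] := f01 (x :&: S).
  have w0 : 0 <= w x by rewrite wE expR_ge0.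
  have := tw x; nra.
rewrite big_split /= -!mulr_sumr /pavg [leRHS]mulrDl.
rewrite -(mulrA (_ / 8)).
rewrite divfK ?expf_neq0 ?pnatr_eq0// lerD2l -[leRHS]mulrA.
by rewrite ler_pM2l; [rewrite mulrC|lra].
Qed.

Lemma exchange_notin (F : V -> {set V} -> R) :
  \sum_i \sum_(T : {set V} | i \notin T) F i T =
  \sum_(T : {set V}) \sum_(i in ~: T) F i T.
Proof.
rewrite (exchange_big_dep xpredT)//=; apply: eq_bigr => T _.
by apply: eq_bigl => i; rewrite inE.
Qed.

(** Substitute [S = i |: T], so that [i] becomes a marked element of [S]. *)
Lemma exchange_setD1 (F : V -> {set V} -> R) :
  \sum_i \sum_(T : {set V} | i \notin T) F i T =
  \sum_(S : {set V}) \sum_(i in S) F i (S :\ i).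
Proof.
rewrite [RHS](exchange_big_dep xpredT)//=; apply: eq_bigr => i _.
rewrite (reindex_onto (fun S => S :\ i) (fun T => i |: T)) /=; last first.
  by move=> T iT; rewrite setU1K.
apply: eq_bigl => S; rewrite setD11 /=.
by apply/eqP/idP => [<-|/setD1K //]; rewrite setU11.
Qed.

Lemma sum_rho_card : \sum_(S : {set V}) rho ^+ #|S| = (1 + rho) ^+ #|V| :> R.
Proof.
rewrite addrC -prodr_const -(sum_set_prod (fun=> rho) (fun=> 1)).
by apply: eq_bigr => S _; rewrite -big_mkcond prodr_const.
Qed.

Lemma rho_ge0 : 0 <= rho :> R. Proof. by rewrite /rho; lra. Qed.

(** Weight the influence bound at [S] by [pavg g (~: S) <= 1]; the errors [rho ^+ #|S|] add up by
    the binomial theorem. *)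
Lemma sum_influence f g : (forall x, 0 <= f x <= 1) -> (forall x, 0 <= g x <= 1) ->
  \sum_(S : {set V}) \sum_(i in S)
    `|pavg f S - pavg f (S :\ i)| * pavg g (~: S) <=
  (\sum_(S : {set V}) #|S|%:R * (pavg f S * pavg g (~: S))) / 8 +
  25 / 2 * (1 + rho) ^+ #|V|.
Proof.
move=> f01 g01; rewrite -sum_rho_card mulr_sumr mulr_suml -big_split /=.
apply: ler_sum => S _; rewrite -mulr_suml.
have g0 : 0 <= pavg g (~: S) by apply: pavg_ge0 => x; case/andP: (g01 x).
have g1 : pavg g (~: S) <= 1 by apply: pavg_le1 => x; case/andP: (g01 x).
apply: (le_trans (ler_wpM2r g0 (pavg_influence S f01))).
have r0 : 0 <= rho ^+ #|S| :> R by rewrite exprn_ge0 ?rho_ge0.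
rewrite mulrDl lerD//; first by lra.
by apply: ler_piMr => //; apply: mulr_ge0 => //; lra.
Qed.

(* Bilinear in each quadrant of (u, v), so it suffices to look at
   u in {0, P, -P} and v in {0, Q, -Q}. *)
Lemma bilinear_bound (P Q u v : R) : `|u| <= P -> `|v| <= Q ->
  (P * (Q - v) + (P - u) * Q) / 2 -
  3 / 2 * (`|u| * (Q - v) + (P - u) * `|v|) <= (P + u) * (Q + v).
Proof.
move=> uP vQ; have [u0|u0] := leP 0 u; have [v0|v0] := leP 0 v;
  rewrite ?(ger0_norm u0) ?(ltr0_norm u0) ?(ger0_norm v0) ?(ltr0_norm v0)
    in uP vQ *; nra.
Qed.

(** The main term gives [1 / 2] and the influences cost [3 / 2 * (1 / 8)], which leaves [5 / 16];
    two errors [25 / 2], times [3 / 2], give [75 / 2]. *)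
Lemma rectangle_corruption f g :
  (forall x, 0 <= f x <= 1) -> (forall x, 0 <= g x <= 1) ->
  5 / 16 * (#|V|%:R * \sum_(S : {set V}) pavg f S * pavg g (~: S)) <=
  \sum_i \sum_(T : {set V} | i \notin T)
     pavg1 f i T * pavg1 g i (~: (i |: T)) +
  75 / 2 * (1 + rho) ^+ #|V|.
Proof.
move=> f01 g01.
have f0 x : 0 <= f x by case/andP: (f01 x).
have g0 x : 0 <= g x by case/andP: (g01 x).
pose W := \sum_(S : {set V}) #|S|%:R * (pavg f S * pavg g (~: S)).
pose W' := \sum_(S : {set V}) #|~: S|%:R * (pavg f S * pavg g (~: S)).
have WW : #|V|%:R * (\sum_(S : {set V}) pavg f S * pavg g (~: S)) = W + W'.
  rewrite mulr_sumr -big_split; apply: eq_bigr => S _ /=.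
  by rewrite -mulrDl -natrD cardsC.
have W'E : W' = \sum_(S : {set V}) #|S|%:R * (pavg g S * pavg f (~: S)).
  rewrite /W' (reindex_inj (@setC_inj V)); apply: eq_bigr => S _ /=.
  by rewrite setCK [pavg f _ * _]mulrC.
(* By [pavg_setU1], [pavg f (i |: T)] plus [u i T] is [pavg1 f i T], and minus [u i T] it is
   [pavg f T]; [v] plays this role around [pavg g (~: T)]. *)
pose u i T := pavg f (i |: T) - pavg f T.
pose v i T := pavg g (~: T) - pavg g (~: (i |: T)).
have A1 : \sum_i \sum_(T : {set V} | i \notin T)
    pavg f (i |: T) * pavg g (~: (i |: T)) = W.
  rewrite exchange_setD1; apply: eq_bigr => S _.
  under eq_bigr => i iS do rewrite setD1K//.
  by rewrite sumr_const mulr_natl.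
have A2 : \sum_i \sum_(T : {set V} | i \notin T) pavg f T * pavg g (~: T) = W'.
  by rewrite exchange_notin; apply: eq_bigr => S _; rewrite sumr_const mulr_natl.
have A3 : \sum_i \sum_(T : {set V} | i \notin T)
    `|u i T| * pavg g (~: (i |: T)) <= W / 8 + 25 / 2 * (1 + rho) ^+ #|V|.
  rewrite exchange_setD1 (le_trans _ (sum_influence f01 g01))//.
  apply: ler_sum => S _; apply: ler_sum => i iS.
  by rewrite /u setD1K.
have A4 : \sum_i \sum_(T : {set V} | i \notin T)
    pavg f T * `|v i T| <= W' / 8 + 25 / 2 * (1 + rho) ^+ #|V|.
  rewrite exchange_notin W'E (le_trans _ (sum_influence g01 f01))//.
  rewrite [leRHS](reindex_inj (@setC_inj V)) /=.
  apply: ler_sum => S _; apply: ler_sum => i iS.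
  by rewrite /v setCK setCU setDE mulrC [in ~: [set i] :&: _]setIC lexx.
rewrite WW.
apply: (@le_trans _ _ (\sum_i \sum_(T : {set V} | i \notin T)
  ((pavg f (i |: T) * pavg g (~: (i |: T)) + pavg f T * pavg g (~: T)) / 2 -
   3 / 2 * (`|u i T| * pavg g (~: (i |: T)) + pavg f T * `|v i T|)) +
  75 / 2 * (1 + rho) ^+ #|V|)).
  under eq_bigr => i _ do
    rewrite sumrB -mulr_suml big_split /= -mulr_sumr big_split /=.
  rewrite sumrB -mulr_suml big_split /= -mulr_sumr big_split /= A1 A2.
  lra.
rewrite lerD2r; apply: ler_sum => i _; apply: ler_sum => T iT.
have iT' : i \notin ~: (i |: T) by rewrite !inE eqxx.
have cT : i |: ~: (i |: T) = ~: T.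
  by apply/setP => j; rewrite !inE; case: eqP => // ->; rewrite iT.
have hf := pavg_setU1 f iT; have hg := pavg_setU1 g iT'; rewrite cT in hg.
have p1 := pavg_ge0 T f0; have p2 := pavg1_ge0 i T f0.
have q1 := pavg_ge0 (~: (i |: T)) g0.
have q2 := pavg1_ge0 i (~: (i |: T)) g0.
have uP : `|u i T| <= pavg f (i |: T) by rewrite ler_norml /u; lra.
have vQ : `|v i T| <= pavg g (~: T) by rewrite ler_norml /v; lra.
have := bilinear_bound uP vQ.
have -> : pavg f (i |: T) + u i T = pavg1 f i T by rewrite /u; lra.
have -> : pavg g (~: T) + v i T = pavg1 g i (~: (i |: T)) by rewrite /v; lra.
by rewrite /u /v !subKr.
Qed.

End Cube.

(** * Rectangles of two-party protocols, and averaging over the seed *)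

Section Protocol.
Context {R : realType} {J M : finType} {X Y : Type}.
Variables (c : J -> R) (a : J -> X) (b : J -> Y) (B : R).
Hypothesis rectangle : forall (f : X -> bool) (g : Y -> bool),
  \sum_j c j * (f (a j) && g (b j))%:R <= B.
Variables (FA : nat -> X -> M -> M) (FB : nat -> Y -> M -> M) (m0 : M).

Definition protocol (l : seq nat) (x : X) (y : Y) : M :=
  foldl (fun m i => FB i y (FA i x m)) m0 l.

Lemma sum_eq_state (P : pred M) (m : M) :
  \sum_m1 (P m1 && (m == m1))%:R = (P m)%:R :> R.
Proof.
rewrite (bigD1 m)//= eqxx andbT big1 ?addr0// => m1 /negPf.
by rewrite eq_sym => ->; rewrite andbF.
Qed.

(* Summing over the two messages of a round cuts a rectangle into at most
   |M|^2 smaller ones. *)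
Lemma protocol_state l (f : X -> bool) (g : Y -> bool) m :
  \sum_j c j * [&& f (a j), g (b j) & protocol l (a j) (b j) == m]%:R <=
  B * (#|M| ^ (2 * size l))%:R.
Proof.
elim/last_ind: l f g m => [|l i IH] f g m.
  rewrite muln0 mulr1 (le_trans _ (rectangle (fun x => f x && (m0 == m)) g))//.
  by apply: ler_sum => j _; rewrite andbAC andbA.
(* With the state [m1] before the round and the first message [m2] fixed, each condition on the
   round involves one input only and is absorbed into [f] or [g]. *)
pose h m1 m2 j : R := c j *
  [&& f (a j) && (FA i (a j) m1 == m2), g (b j) && (FB i (b j) m2 == m) &
      protocol l (a j) (b j) == m1]%:R.
have -> : \sum_j c j * [&& f (a j), g (b j) &
    protocol (rcons l i) (a j) (b j) == m]%:R =
    \sum_m1 \sum_m2 \sum_j h m1 m2 j.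
  under [RHS]eq_bigr => m1 _ do rewrite exchange_big /=.
  rewrite [RHS]exchange_big /=; apply: eq_bigr => j _.
  rewrite /h; under [RHS]eq_bigr => m1 _ do rewrite -mulr_sumr.
  rewrite -mulr_sumr; congr (_ * _).
  rewrite /protocol foldl_rcons; set r := foldl _ _ _.
  rewrite -(sum_eq_state (fun m1 => [&& f (a j), g (b j) &
    FB i (b j) (FA i (a j) m1) == m])); apply: eq_bigr => m1 _.
  rewrite -!andbA -[LHS](sum_eq_state (fun m2 => [&& f (a j), g (b j),
    FB i (b j) m2 == m & r == m1]) (FA i (a j) m1)).
  by apply: eq_bigr => m2 _; congr (_%:R);
    case: (f (a j)); case: (g (b j)); case: (_ == m2); case: (_ == m);
    case: (r == m1).
have -> : B * (#|M| ^ (2 * size (rcons l i)))%:R =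
    \sum_(m1 : M) \sum_(m2 : M) B * (#|M| ^ (2 * size l))%:R.
  rewrite !sumr_const -mulrnA -[RHS]mulr_natr -mulrA -natrM size_rcons mulnS.
  by rewrite expnD mulnC.
by apply: ler_sum => m1 _; apply: ler_sum => m2 _;
  exact: (IH (fun x => f x && (FA i x m1 == m2)) (fun y => g y && (FB i y m2 == m))).
Qed.

(** The extra factor [#|M|] pays for the sum over final states; rejected states contribute 0, which
    is at most their share since [0 <= B]. *)
Lemma protocol_output l (o : pred M) : 0 <= B ->
  \sum_j c j * (o (protocol l (a j) (b j)))%:R <=
  B * (#|M| ^ (2 * size l).+1)%:R.
Proof.
move=> B0.
under eq_bigr => j _ do rewrite -sum_eq_state mulr_sumr.
rewrite exchange_big /= expnS natrM mulrCA mulr_natl -sumr_const.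
apply: ler_sum => m _.
have [om|om] := boolP (o m).
  exact: (le_trans _ (protocol_state l (fun=> true) (fun=> true) m)).
by rewrite big1 ?mulr_ge0// => j _; rewrite mulr0.
Qed.

End Protocol.

(** The easy direction of Yao's principle: integrate over [w] the bound that holds for every fixed
    seed. *)
Lemma average_indic (R : realType) (d : measure_display) (T : measurableType d)
    (P : probability T R) (J : finType) (c : J -> R) (A : J -> set T) (B q : R) :
  (forall j, 0 <= c j) -> (forall j, measurable (A j)) ->
  (forall j, q%:E <= P (A j))%E ->
  (forall w, \sum_j c j * \1_(A j) w <= B) ->
  q * \sum_j c j <= B.
Proof.
move=> c0 mA qA AB.
have cP : (\sum_j (c j)%:E * P (A j) =
           \int[P]_w (\sum_j c j * \1_(A j) w)%:E)%E.
  under [in RHS]eq_integral => w _ do rewrite -sumEFin.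
  rewrite ge0_integral_sum//=; last 2 first.
  - move=> j; apply/measurable_EFinP; apply: measurable_funM => //.
  - by move=> j w _; rewrite lee_fin mulr_ge0.
  apply: eq_bigr => j _.
  under eq_integral => w _ do rewrite EFinM.
  rewrite ge0_integralZl_EFin//=; last exact/measurable_EFinP.
  by rewrite integral_indic// setIT.
have {}cP : (\sum_j (c j)%:E * P (A j) <= B%:E)%E.
  rewrite cP (_ : B%:E = \int[P]_w (cst B%:E w))%E; last first.
    by rewrite integral_cst//= probability_setT mule1.
  apply: ge0_le_integral => //=.
  - by move=> w _; rewrite lee_fin sumr_ge0// => j _; rewrite mulr_ge0.
  - apply/measurable_EFinP; apply: measurable_sum => j.
    by apply: measurable_funM => //.
  - by move=> w _; rewrite lee_fin.
rewrite -lee_fin; apply: (le_trans _ cP).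
rewrite mulr_sumr -sumEFin; apply: lee_sum => j _.
by rewrite mulrC EFinM lee_wpmul2l// lee_fin.
Qed.

(** * When [min_fas] vanishes and when it does not *)

Section MinFas.
Import mathcomp.boot.finset.
Context {n : nat}.
Implicit Types (E : {set 'I_n * 'I_n}).

Lemma min_fas_le E (sigma : 'S_n) : (min_fas E <= #|back_edges E sigma|)%N.
Proof. by rewrite /min_fas; case: arg_minnP => // i _; apply. Qed.

(** Ranking [v] by the number of smaller keys gives a permutation without back edges. *)
Lemma min_fas_eq0 E (key : 'I_n -> nat) : injective key ->
  (forall u v, (u, v) \in E -> (key u < key v)%N) -> min_fas E = 0%N.
Proof.
move=> keyI keyE.
pose below v := [set u | (key u < key v)%N].
have below_lt v : (#|below v| < n)%N.
  rewrite -[X in (_ < X)%N]card_ord -cardsT; apply: proper_card.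
  by apply/properP; split; [exact: subsetT|exists v; rewrite !inE ?ltnn].
pose rank v := Ordinal (below_lt v).
have rank_lt u v : (key u < key v)%N -> (rank u < rank v)%N.
  move=> uv; apply: proper_card; apply/properP; split.
    by apply/fintype.subsetP => w; rewrite !inE => /ltn_trans; exact.
  by exists u; rewrite !inE ?ltnn.
have rankI : injective rank.
  move=> u v uv; apply: keyI; case: (ltngtP (key u) (key v)) => // /rank_lt;
  by rewrite uv ltnn.
have := min_fas_le E (perm rankI).
rewrite (_ : back_edges E _ = set0) ?cards0 ?leqn0; first by move/eqP.
apply/setP => -[u v]; rewrite !inE /= !permE; apply/negP => /andP[/keyE uv].
by rewrite ltnNge ltnW// rank_lt.
Qed.

(** An ordering without back edges would be weakly increasing all the way round the cycle, hence
    constant on it. *)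
Lemma min_fas_gt0 E (u v w : 'I_n) : u != v ->
  (u, v) \in E -> (v, w) \in E -> (w, u) \in E -> (0 < min_fas E)%N.
Proof.
move=> neuv uv vw wu; rewrite /min_fas; set sigma := [arg min_(_ < _) _].
have neq a b : (a, b) \in E -> (sigma b < sigma a)%N ->
    (0 < #|back_edges E sigma|)%N.
  by move=> ab ba; apply/card_gt0P; exists (a, b); rewrite inE ab.
case: (ltnP (sigma v) (sigma u)) => [|uv']; first exact: neq.
case: (ltnP (sigma w) (sigma v)) => [|vw']; first exact: neq.
case: (ltnP (sigma u) (sigma w)) => [|wu']; first exact: neq.
have /perm_inj uvE : sigma u = sigma v 
  by apply/val_inj/eqP; rewrite eqn_leq uv' (leq_trans vw' wu').
by rewrite uvE eqxx in neuv.
Qed.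

End MinFas.

(** * From set disjointness to streamed tournaments *)

Section Reduction.
Local Open Scope nat_scope.
Import mathcomp.boot.finset.
Context {n : nat}.
Local Notation V := 'I_(n %/ 3).
Implicit Types (x y : {set V}).

(* Triples are {3k, 3k+1, 3k+2}; k stands in x for the edge 3k -> 3k+1, and in
   y for 3k+1 -> 3k+2. *)
Definition in_nat x (k : nat) : bool := [exists i in x, i == k :> nat].

Definition triple_arc (bx by_ : bool) (r1 r2 : nat) : bool :=
  match r1, r2 with
  | 0, 1 => bx | 1, 0 => ~~ bx
  | 1, 2 => by_ | 2, 1 => ~~ by_
  | 2, 0 => true | _, _ => false
  end.

(** The [n %% 3] leftover vertices have block index [n %/ 3], which lies in neither set, so their
    block is acyclic. *)
Definition arc x y (u v : nat) : bool :=
  if u %/ 3 == v %/ 3 then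
    triple_arc (in_nat x (u %/ 3)) (in_nat y (u %/ 3)) (u %% 3) (v %% 3)
  else (u < v)%N.

Definition triples x y : {set 'I_n * 'I_n} :=
  [set e : 'I_n * 'I_n | arc x y e.1 e.2].

Lemma arc_irr x y u : arc x y u u = false.
Proof. by rewrite /arc eqxx; case: (u %% 3) => [|[|[|]]]. Qed.

Lemma arc_total x y u v : u != v -> arc x y u v (+) arc x y v u.
Proof.
move=> uv; rewrite /arc [v %/ 3 == _]eq_sym; case: eqP => [e|_]; last first.
  by case: ltngtP uv.
have r : u %% 3 != v %% 3.
  by apply: contra uv => /eqP r; rewrite (divn_eq u 3) (divn_eq v 3) e r.
rewrite -e; move: r (ltn_pmod u (isT : 0 < 3)%N) (ltn_pmod v (isT : 0 < 3)%N).
by move: (u %% 3) (v %% 3) (in_nat x _) (in_nat y _) =>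
  [|[|[|//]]] [|[|[|//]]] [] [].
Qed.

Lemma triples_tournament x y : tournament (triples x y).
Proof.
split=> [v|u v uv]; first by rewrite inE arc_irr.
by rewrite !inE arc_total.
Qed.

(** A topological order of the triple unless both bits are set: c, a, b if [bx]; b, c, a if only
    [by_]; c, b, a if neither. *)
Definition triple_pos (bx by_ : bool) (r : nat) : nat :=
  if bx then nth 0%N [:: 1; 2; 0]%N r
  else if by_ then nth 0%N [:: 2; 0; 1]%N r else nth 0%N [:: 2; 1; 0]%N r.

(** Sort by block, then by [triple_pos]; disjointness excludes the cyclic case. *)
Lemma triples_disjoint x y : [disjoint x & y] -> min_fas (triples x y) = 0%N.
Proof.
move=> xy.
have disj k : in_nat x k && in_nat y k = false.
  apply/negP => /andP[/'exists_andP[i [ix /eqP <-]] /'exists_andP[j [jy]]].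
  move=> /eqP/val_inj ji; subst j.
  by have := disjoint_setI0 xy => /setP/(_ i); rewrite !inE ix jy.
pose key (v : 'I_n) : nat := (3 * (v %/ 3) +
  triple_pos (in_nat x (v %/ 3)) (in_nat y (v %/ 3)) (v %% 3))%N.
have pos3 bx by_ r : (r < 3)%N -> (triple_pos bx by_ r < 3)%N.
  by move: bx by_ r => [] [] [|[|[|]]].
have key_div u : (key u %/ 3 = u %/ 3).
  by rewrite /key mulnC divnMDl// (divn_small (pos3 _ _ _ (ltn_pmod u _))) ?addn0.
apply: (min_fas_eq0 (key := key)) => [u v uv|u v].
  have e : u %/ 3 = v %/ 3 by rewrite -key_div uv key_div.
  apply: val_inj; rewrite /= (divn_eq u 3) (divn_eq v 3) e; congr (_ + _)%N.
  move: uv; rewrite /key e => /addnI.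
  move: (ltn_pmod u (isT : 0 < 3)%N) (ltn_pmod v (isT : 0 < 3)%N).
  by move: (u %% 3) (v %% 3) (in_nat x _) (in_nat y _) =>
    [|[|[|//]]] [|[|[|//]]] [] [].
rewrite inE /arc /=; case: eqP => [e|]; last first.
  have := key_div u; have := key_div v; lia.
rewrite /key -e ltn_add2l; move: (disj (u %/ 3)).
move: (ltn_pmod u (isT : 0 < 3)%N) (ltn_pmod v (isT : 0 < 3)%N).
by move: (u %% 3) (v %% 3) (in_nat x _) (in_nat y _) =>
  [|[|[|//]]] [|[|[|//]]] [] [].
Qed.

Lemma triples_intersect x y i : i \in x -> i \in y ->
  (0 < min_fas (triples x y))%N.
Proof.
move=> ix iy.
have lt r : (r < 3 -> 3 * i + r < n)%N.
  by have := ltn_ord i; have := leq_trunc_div n 3; lia.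
have inx : in_nat x i by apply/'exists_andP; exists i.
have iny : in_nat y i by apply/'exists_andP; exists i.
have arcE (r r' : nat) : (r < 3)%N -> (r' < 3)%N ->
    arc x y (3 * i + r) (3 * i + r') = triple_arc true true r r'.
  move=> r3 r'3; rewrite /arc !(mulnC 3) !divnMDl// !modnMDl.
  rewrite (divn_small r3) (divn_small r'3) (modn_small r3) (modn_small r'3).
  by rewrite addn0 eqxx inx iny.
by apply: (@min_fas_gt0 _ _ (Ordinal (lt 0%N isT)) (Ordinal (lt 1%N isT))
  (Ordinal (lt 2%N isT))); rewrite ?inE /= ?arcE// -val_eqE /=; lia.
Qed.

(** Within [pairs], these are the pairs b, c of one triple, the only ones whose orientation depends
    on [y]. *)
Definition bob_pair (p : 'I_n * 'I_n) : bool :=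
  [&& p.1 %/ 3 == p.2 %/ 3, p.1 %% 3 != 0 & p.2 %% 3 != 0]%N.

Definition pairs : seq ('I_n * 'I_n) :=
  [seq p : 'I_n * 'I_n <- enum {: 'I_n * 'I_n} | p.1 < p.2].

Definition orient x y (p : 'I_n * 'I_n) : 'I_n * 'I_n :=
  if arc x y p.1 p.2 then p else (p.2, p.1).

Definition alice_edges x : seq ('I_n * 'I_n) :=
  [seq orient x set0 p | p <- pairs & ~~ bob_pair p].

Definition bob_edges y : seq ('I_n * 'I_n) :=
  [seq orient set0 y p | p <- pairs & bob_pair p].

Lemma alice_arc x y (p : 'I_n * 'I_n) : ~~ bob_pair p ->
  arc x set0 p.1 p.2 = arc x y p.1 p.2.
Proof.
rewrite /bob_pair /arc; case: (_ =P _) => //= _; rewrite negb_and !negbK.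
by case: (p.1 %% 3) (p.2 %% 3) => [|[|[|?]]] [|[|[|?]]].
Qed.

Lemma bob_arc x y (p : 'I_n * 'I_n) : bob_pair p -> arc set0 y p.1 p.2 = arc x y p.1 p.2.
Proof.
rewrite /bob_pair /arc; case: (_ =P _) => //= _.
by case: (p.1 %% 3) (p.2 %% 3) => [|[|[|?]]] [|[|[|?]]].
Qed.

(** Every unordered pair is oriented once, and by [arc_total] these orientations are all the
    edges. *)
Lemma stream_triples x y :
  edge_stream (triples x y) (alice_edges x ++ bob_edges y).
Proof.
rewrite /edge_stream.
have -> : alice_edges x ++ bob_edges y =
    map (orient x y) ([seq p <- pairs | ~~ bob_pair p] ++
                      [seq p <- pairs | bob_pair p]).
  rewrite map_cat; congr (_ ++ _); apply/eq_in_map => p;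
    rewrite mem_filter /orient => /andP[bp _].
    by rewrite (alice_arc x y bp).
  by rewrite (bob_arc x y bp).
apply: (@perm_trans _ (map (orient x y) pairs)).
  by apply: perm_map; rewrite perm_catC; exact/permEl/perm_filterC.
have memp p : (p \in pairs) = (p.1 < p.2)%N.
  by rewrite mem_filter mem_enum andbT.
apply: uniq_perm; rewrite ?enum_uniq//.
  rewrite map_inj_in_uniq; first exact/filter_uniq/enum_uniq.
  move=> [a b] [c d].
  rewrite !memp /= /orient /= => ab cd.
  by case: ifP => _; case: ifP => _ // -[ac bd]; subst;
    rewrite // ltnNge ltnW in ab.
move=> [u v]; rewrite mem_enum inE /=; apply/mapP/idP => [[[a b]]|uv].
  rewrite memp /orient /= => ab; case: ifP => abE [-> ->] //.
  by have := arc_total x y (negbT (ltn_eqF ab)); rewrite abE.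
have : u != v :> nat by apply: contraTneq uv => ->; rewrite arc_irr.
rewrite neq_ltn => /orP[lt|lt].
  by exists (u, v); rewrite ?memp// /orient uv.
exists (v, u); rewrite ?memp// /orient /=.
by have := arc_total x y (negbT (gtn_eqF lt)); rewrite uv /= => /negPf ->.
Qed.

Context {s : nat} {T : Type}.
Variables (A : stream_alg n s T) (w : T).

Definition updates (st : seq ('I_n * 'I_n)) (k : nat) (i : nat)
    (m : s.-tuple bool) : s.-tuple bool :=
  foldl (fun m' je => sa_update A w i je.1 m' je.2) m
    (zip (iota k (size st)) st).

Lemma sa_pass_cat st1 st2 m i : sa_pass A w (st1 ++ st2) m i =
  updates st2 (size st1) i (updates st1 0 i m).
Proof.
by rewrite /sa_pass size_cat iotaD zip_cat ?size_iota// foldl_cat add0n.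
Qed.

Definition alice_move (i : nat) x (m : s.-tuple bool) :=
  updates (alice_edges x) 0 i m.

(** Bob's clock starts at the length of Alice's part; it is the same for every [x], so [set0] stands
    in for the set that Bob does not know. *)
Definition bob_move (i : nat) y (m : s.-tuple bool) :=
  updates (bob_edges y) (size (alice_edges set0)) i m.

Lemma sa_run_moves p x y : sa_run A p w (alice_edges x ++ bob_edges y) =
  sa_output A w (foldl (fun m i => bob_move i y (alice_move i x m))
                   (sa_init A w) (iota 0 p)).
Proof.
rewrite /sa_run; congr (sa_output A w _).
elim: (iota 0 p) (sa_init A w) => //= i l IH m; rewrite IH; congr foldl.
rewrite sa_pass_cat /bob_move /alice_move.
by rewrite (_ : size (alice_edges x) = size (alice_edges set0)) ?size_map.
Qed.

End Reduction.

(** * A signed hard distribution for disjointness *)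

Section HardDistribution.
Import mathcomp.boot.finset.
Context {R : realType} {V : finType}.

(** Left: disjoint pairs separated by [U]. Right: pairs meeting exactly in [i]. Letting [x] and [y]
    range over all sets makes the sums factor into [pavg] and [pavg1]. *)
Definition hard_index : finType :=
  ({set V} * {set V} * {set V} + V * {set V} * {set V} * {set V})%type.

Definition hard_x (j : hard_index) : {set V} :=
  match j with
  | inl (U, x, y) => x :&: U
  | inr (i, U, x, y) => i |: (x :&: U)
  end.

Definition hard_y (j : hard_index) : {set V} :=
  match j with
  | inl (U, x, y) => y :&: ~: U
  | inr (i, U, x, y) => i |: (y :&: ~: (i |: U))
  end.

Definition hard_weight (j : hard_index) : R :=
  match j with
  | inl _ => 5 / 16 * #|V|%:R
  | inr (i, U, x, y) => - (i \notin U)%:R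
  end.

Lemma sum_hard (F : hard_index -> R) :
  \sum_j F j = \sum_(U : {set V}) \sum_(x : {set V}) \sum_(y : {set V}) F (inl (U, x, y)) +
               \sum_i \sum_(U : {set V}) \sum_(x : {set V}) \sum_(y : {set V}) F (inr (i, U, x, y)).
Proof.
rewrite big_sumType; congr (_ + _).
  rewrite !pair_bigA; apply: eq_bigr => -[[? ?] ?] _ //.
rewrite !pair_bigA; apply: eq_bigr => -[[[? ?] ?] ?] _ //.
Qed.

Lemma hard_inl_disjoint t : [disjoint hard_x (inl t) & hard_y (inl t)].
Proof.
case: t => -[U x] y; rewrite -setI_eq0; apply/eqP/setP => i /=; rewrite !inE.
by case: (i \in U); rewrite !(andbF, andbT).
Qed.

Lemma sum2_const (r : R) :
  \sum_(x : {set V}) \sum_(y : {set V}) r = 4 ^+ #|V| * r.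
Proof.
rewrite !sumr_const -mulrnA card_setT_exp -[LHS]mulr_natl natrM natrX -exprMn.
by congr (_ ^+ _ * _); ring.
Qed.

Lemma sum2_pavg (f g : {set V} -> R) U U' :
  \sum_(x : {set V}) \sum_(y : {set V}) f (x :&: U) * g (y :&: U') =
  4 ^+ #|V| * (pavg f U * pavg g U').
Proof.
rewrite (_ : 4 = 2 * 2 :> R) ?exprMn; last by ring.
rewrite /pavg mulrACA !mulrA -big_distrlr /=; field.
by rewrite expf_neq0.
Qed.

Lemma sum2_pavg1 (f g : {set V} -> R) i U U' :
  \sum_(x : {set V}) \sum_(y : {set V}) f (i |: (x :&: U)) * g (i |: (y :&: U')) =
  4 ^+ #|V| * (pavg1 f i U * pavg1 g i U').
Proof. exact: (sum2_pavg (fun x => f (i |: x)) (fun x => g (i |: x))). Qed.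

(** This is [rectangle_corruption] for indicators, scaled by the [4 ^+ #|V|] choices of [x] and
    [y]. *)
Lemma hard_rectangle (f g : {set V} -> bool) :
  \sum_j hard_weight j * (f (hard_x j) && g (hard_y j))%:R <=
  75 / 2 * (1 + rho) ^+ #|V| * 4 ^+ #|V|.
Proof.
pose F x : R := (f x)%:R; pose G x : R := (g x)%:R.
have b01 (b : bool) : 0 <= (b%:R : R) <= 1 by case: b; rewrite ?ler01 ?lexx.
have := @rectangle_corruption R V F G (fun x => b01 (f x)) (fun x => b01 (g x)).
rewrite -(ler_pM2l (exprn_gt0 #|V| (ltr0n R 4))) => /le_trans h.
rewrite sum_hard /=.
under eq_bigr => U _ do under eq_bigr => x _ do under eq_bigr => y _ do
  rewrite -mulnb natrM.
under eq_bigr => U _ do under eq_bigr => x _ do rewrite -mulr_sumr.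
under eq_bigr => U _ do rewrite -mulr_sumr (sum2_pavg F G).
rewrite -mulr_sumr -mulr_sumr.
have -> : \sum_i \sum_(U : {set V}) \sum_(x : {set V}) \sum_(y : {set V}) - (i \notin U)%:R *
   (f (i |: x :&: U) && g (i |: y :&: ~: (i |: U)))%:R =
   - (4 ^+ #|V| * \sum_i \sum_(U : {set V} | i \notin U)
     pavg1 F i U * pavg1 G i (~: (i |: U))).
  rewrite mulr_sumr -sumrN; apply: eq_bigr => i _.
  rewrite mulr_sumr -sumrN [RHS]big_mkcond; apply: eq_bigr => U _ /=.
  rewrite -(sum2_pavg1 F G); case: ifP => _; last first.
    by apply: big1 => x _; apply: big1 => y _; rewrite oppr0 mul0r.
  rewrite -sumrN; apply: eq_bigr => x _; rewrite -sumrN; apply: eq_bigr => y _.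
  by rewrite mulN1r -mulnb natrM.
have := h _ (lexx _); lra.
Qed.

Lemma sum_hard_weight_inl (r : R) :
  \sum_(t : {set V} * {set V} * {set V}) r = 8 ^+ #|V| * r.
Proof.
rewrite sumr_const !card_prod card_setT_exp -[LHS]mulr_natl !natrM natrX -!exprMn.
by congr (_ ^+ _ * _); ring.
Qed.

Lemma sum_hard_weight_inr :
  \sum_i \sum_(U : {set V}) \sum_(x : {set V}) \sum_(y : {set V}) (i \notin U)%:R =
  #|V|%:R * 8 ^+ #|V| / 2 :> R.
Proof.
have h i : \sum_(U : {set V}) (i \notin U)%:R = 2 ^+ #|V| / 2 :> R.
  have := @sum_set_split R V i (fun=> 1).
  rewrite sumr_const card_setT_exp natrX => ->.
  rewrite [in RHS]big_mkcond mulr_suml; apply: eq_bigr => U _.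
  by case: (i \notin U) => /=; lra.
under eq_bigr => i _.
  under eq_bigr => U _ do rewrite sum2_const.
  rewrite -mulr_sumr h; over.
rewrite sumr_const -[LHS]mulr_natl.
rewrite (_ : 8 = 4 * 2 :> R); last by ring.
by rewrite exprMn !mulrA.
Qed.

End HardDistribution.
Arguments hard_index : clear implicits.


(** * The resulting bound on passes and memory *)

Section LowerBound.
Context {R : realType} {n s p : nat} {d : measure_display}.
Context {T : measurableType d} {P : probability T R}.
Variables (A : stream_alg n s T) (alpha : R).
Hypothesis sol : solves_fas_size_t P A p alpha.
Local Notation V := 'I_(n %/ 3).

(** In units of [#|V| * 8 ^+ #|V|] the absolute weights total [5 / 16 + 1 / 2 = 13 / 16]. Success
    [2 / 3] collects [13 / 24], which exceeds the [1 / 2] in [succP'] by [1 / 24]; [B] must cover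
    this, and [900 = 24 * (75 / 2)]. *)
Lemma communication_bound :
  (n %/ 3)%:R * 2 ^+ (n %/ 3) <=
  900 * ((1 + rho) ^+ (n %/ 3) * (2 ^ (s * (2 * p).+1))%:R) :> R.
Proof.
pose st (j : hard_index V) :=
  alice_edges (hard_x j) ++ bob_edges (hard_y j).
pose E (j : hard_index V) := triples (hard_x j) (hard_y j) : {set 'I_n * 'I_n}.
(* Whatever [alpha] is, a correct output is 0 exactly when [min_fas] is, so output 0 is read as the
   answer that the sets are disjoint. *)
pose acc w (j : hard_index V) := sa_run A p w (st j) == 0.
pose succ (j : hard_index V) := [set w | fas_size_approx alpha (E j) (sa_run A p w (st j))]%classic.
have succP j : measurable (succ j) /\ ((2 / 3)%:E <= P (succ j))%E.
  exact: (sol (triples_tournament _ _) (stream_triples _ _)).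
pose B : R := 75 / 2 * (1 + rho) ^+ #|V| * 4 ^+ #|V| *
  (2 ^ (s * (2 * p).+1))%:R.
have accP w : \sum_j hard_weight j * (acc w j)%:R <= B.
  have := @protocol_output R _ _ _ _ _ _ _ _ (@hard_rectangle R V)
    (alice_move A w) (bob_move A w) (sa_init A w) (iota 0 p)
    (fun m => sa_output A w m == 0).
  rewrite card_tuple card_bool size_iota -expnM => h.
  under eq_bigr => j _ do rewrite /acc /st sa_run_moves.
  apply: h; rewrite !mulr_ge0 ?exprn_ge0 ?addr_ge0 ?rho_ge0//; lra.
have succ0 t w : \1_(succ (inl t)) w <= (acc w (inl t))%:R :> R.
  rewrite indicE; case: (boolP (w \in succ _)) => //; rewrite inE /succ /=.
  rewrite /fas_size_approx /E triples_disjoint ?hard_inl_disjoint// mulr0.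
  move=> [h1 h2]; have /eqP : (sa_run A p w (st (inl t)))%:~R = 0 :> R.
    by apply/eqP; rewrite eq_le h1 h2.
  by rewrite intr_eq0 /acc => ->.
have succ1 t w : \1_(succ (inr t)) w <= 1 - (acc w (inr t))%:R :> R.
  rewrite indicE; case: (boolP (w \in succ _)) => [|_]; last first.
    by case: (acc _ _) => /=; lra.
  rewrite inE /succ /= /fas_size_approx => -[h1 _].
  have i0 : (0 < min_fas (E (inr t)))%N.
    case: t h1 => -[[i U] x] y _.
    by apply: (triples_intersect (i := i)); rewrite /= !inE eqxx.
  rewrite /acc; case: eqP => [e|_]; last by rewrite subr0.
  by move: h1; rewrite e lern0 -leqn0 leqNgt i0.
(* Adding [e] turns the negative term of an intersecting pair into [1 - acc], which bounds its
   success. *)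
pose e (j : hard_index V) : R := if j is inr (i, U, x, y) then (i \notin U)%:R else 0.
have sum_e : \sum_j e j = #|V|%:R * 8 ^+ #|V| / 2.
  rewrite sum_hard /= sum_hard_weight_inr [X in X + _]big1 ?add0r// => U _.
  by rewrite big1// => x _; rewrite big1.
have succP' w : \sum_j `|hard_weight j| * \1_(succ j) w <=
    B + #|V|%:R * 8 ^+ #|V| / 2.
  rewrite -sum_e (le_trans _ (lerD (accP w) (lexx _)))// -big_split /=.
  apply: ler_sum => -[[[U x] y]|[[[i U] x] y]] _ /=.
    rewrite addr0 ger0_norm ?ler_wpM2l//; lra.
  rewrite normrN ger0_norm//; have := succ1 (i, U, x, y) w.
  by case: (i \notin U) => /=; lra.
have := @average_indic R d T P _ (fun j => `|hard_weight j|) succ _ _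
  (fun j => normr_ge0 _) (fun j => (succP j).1) (fun j => (succP j).2) succP'.
have -> : \sum_(j : hard_index V) `|hard_weight j| = 13 / 16 * (#|V|%:R * 8 ^+ #|V|) :> R.
  transitivity (\sum_(j : hard_index V) (`|hard_weight j| - e j) +
      \sum_j e j : R).
    by rewrite sumrB subrK.
  rewrite sum_e big_sumType /= [X in _ + X + _]big1; last first.
    by move=> -[[[i U] x] y] _; rewrite /= normrN ger0_norm ?subrr.
  rewrite (eq_bigr (fun=> 5 / 16 * #|V|%:R)); last first.
    by move=> -[[U x] y] _; rewrite /= subr0 ger0_norm//; lra.
  by rewrite sum_hard_weight_inl; lra.
rewrite /B card_ord (_ : 8 = 4 * 2 :> R); last by ring.
rewrite (exprMn _ 4 2) => h.
by rewrite -(ler_pM2l (exprn_gt0 (n %/ 3) (ltr0n R 4))); lra.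
Qed.

End LowerBound.

(** * Exponential gap and final constants *)

Lemma bernoulli_le (R : realType) (x : R) (n : nat) :
  0 <= x -> 1 + n%:R * x <= (1 + x) ^+ n.
Proof.
move=> x0; elim: n => [|n IH]; first by rewrite mul0r addr0.
rewrite exprS mulrS; have n0 : 0 <= n%:R :> R by []; nra.
Qed.

(** As [2 = (1 + 1 / 599) * (1 + rho)], Bernoulli's inequality gains a factor 2 on every [k]
    factors; the other [n %% k] factors use [1 + rho <= 2]. *)
Lemma exp2_le_rho (R : realType) (k n : nat) : (599 <= k)%N ->
  2 ^+ (n %/ k) * (1 + rho) ^+ n <= 2 ^+ n :> R.
Proof.
rewrite -(ler_nat R) => k_ge.
have r0 : 0 <= 1 + rho :> R by rewrite addr_ge0 ?rho_ge0.
have h : 2 * (1 + rho) ^+ k <= 2 ^+ k :> R.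
  have -> : 2 = (1 + 1 / 599) * (1 + rho) :> R by rewrite /rho; lra.
  rewrite [leRHS]exprMn ler_wpM2r ?exprn_ge0//.
  have := @bernoulli_le R (1 / 599) k ltac:(lra); rewrite /rho; lra.
have e : n = (k * (n %/ k) + n %% k)%N by rewrite mulnC -divn_eq.
rewrite [in X in _ * X]e [in leRHS]e !exprD !exprM mulrA.
rewrite -[(2 : R) ^+ (n %/ k) * _]exprMn.
apply: ler_pM; rewrite ?exprn_ge0 ?mulr_ge0 ?exprn_ge0//.
  by rewrite lerXn2r ?nnegrE ?mulr_ge0 ?exprn_ge0.
by rewrite lerXn2r ?nnegrE//; rewrite /rho; lra.
Qed.

Theorem theorem3p7 (R : realType) :
  exists c : R, 0 < c /\
  exists n0 : nat,
  forall (n p s : nat) (d : measure_display) (T : measurableType d)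
    (P : probability T R) (A : stream_alg n s T) (alpha : R),
    (n0 <= n)%N -> (0 < p)%N -> 1 <= alpha ->
    solves_fas_size_t P A p alpha ->
    c * (n%:R / p%:R) <= s%:R.
Proof.
exists (1 / (100 * 100)); split; first by lra.
exists (300 * 300)%N => n p s d T P A alpha n_ge p0 _ sol.
have := communication_bound sol; set N := (n %/ 3)%N => bound.
have N0 : (0 < N)%N by rewrite divn_gt0//; lia.
(* The factor 900 is at most [2 ^+ 10], and [1 <= N] lets the factor [N] be dropped. *)
have {}bound : (2 ^+ (N %/ 600) <= 2 ^+ (10 + s * (2 * p).+1) :> R).
  have r0 : 0 < (1 + rho) ^+ N :> R by rewrite exprn_gt0// /rho; lra.
  rewrite -(ler_pM2r r0) (le_trans (exp2_le_rho _ _ _))//.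
  have N1 : 1 <= N%:R :> R by rewrite ler1n.
  have t0 : 0 <= 2 ^+ N :> R by rewrite exprn_ge0.
  apply: (le_trans (ler_peMl t0 N1)); apply: (le_trans bound).
  rewrite natrX exprD -[leRHS]mulrA [in leRHS](mulrC _ ((1 + rho) ^+ N)).
  rewrite ler_wpM2r ?mulr_ge0 ?exprn_ge0 ?addr_ge0 ?rho_ge0//.
  by rewrite -natrX ler_nat.
have {bound} : (N %/ 600 <= 10 + s * (2 * p).+1)%N.
  by move: bound; rewrite ler_eXn2l ?ltr1n.
move=> bound.
(* Here [n < 1800 * (N %/ 600 + 1) <= 19800 + 5400 * (s * p)], and [n >= 90000] absorbs the additive
   term. *)
have {bound} : (n <= 100 * 100 * (s * p))%N.
  have h : (s * (2 * p).+1 <= 3 * (s * p))%N by rewrite mulnCA leq_mul//; lia.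
  have := ltn_ceil n (isT : 0 < 3)%N; have := ltn_ceil N (isT : 0 < 600)%N.
  rewrite -/N; move: (N %/ 600)%N bound => k.
  by move: (s * p)%N (s * _)%N h => a b; lia.
rewrite mulrA ler_pdivrMr ?ltr0n// -natrM -(ler_nat R) !natrM; lra.
Qed.
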